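(* Let $\mathcal S\subset\{-1,0,1\}^d$ be a weighted small-step set which is irreducible in the orthant, meaning that for any two lattice points $P,Q\in\mathbb Z_{\ge0}^d$ there is a walk of some length $n\ge1$ from $P$ to $Q$ with all steps in $\mathcal S$ and all points in $\mathbb R_+^d$, with combinatorial group $G=\langle\varphi_1,\dots,\varphi_d\rangle$ and reflection group $H=\langle r_1,\dots,r_d\rangle$ as defined in the context. If $G$ is finite, then $H$ is finite.
   Context: Setting. $d\ge1$, $\mathcal S\subset\{-1,0,1\}^d$ is a step set; each $s\in\mathcal S$ carries a weight $w(s)>0$, normalized by $\sum_{s\in\mathcal S}w(s)=1$. For $P,Q\in\mathbb Z_{\ge0}^d$, $e_C(P,Q;n)$ denotes the weighted number of walks of length $n$ from $P$ to $Q$ with steps in $\mathcal S$ and all points in the orthant $C=\mathbb R_+^d$. Irreducibility: for any two lattice points $P,Q\in\mathbb Z_{\ge 0}^d$ there is $n\ge1$ with $e_C(P,Q;n)\neq0$. Inventory: $\chi_{\mathcal S}(x_1,\dots,x_d)=\sum_{s\in\mathcal S}w(s)x_1^{s_1}\cdots x_d^{s_d}$. Under irreducibility (known fact) the system $\partial\chi_{\mathcal S}/\partial x_1=\dots=\partial\chi_{\mathcal S}/\partial x_d=0$ has a unique solution $\boldsymbol{x_0}$ in $(0,\infty)^d$, which is the minimum of $\chi_{\mathcal S}$ on $(0,\infty)^d$. Covariance matrix: $\Delta=(a_{i,j})$ with $a_{i,j}=\dfrac{\partial_{x_i}\partial_{x_j}\chi_{\mathcal S}(\boldsymbol{x_0})}{\sqrt{\partial_{x_i}^2\chi_{\mathcal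 S}(\boldsymbol{x_0})\,\partial_{x_j}^2\chi_{\mathcal S}(\boldsymbol{x_0})}}$. It is symmetric positive definite with unit diagonal; $\Delta^{1/2}$ is its symmetric positive definite square root. Group $G$: for each $i$ write $\chi_{\mathcal S}=x_iA_i+B_i+x_i^{-1}C_i$ with $A_i,B_i,C_i$ Laurent polynomials not depending on $x_i$. Let $\varphi_i$ be the birational involution replacing the $i$-th coordinate $x_i$ by $\frac{1}{x_i}\frac{C_i}{A_i}$ and fixing the other coordinates. $G=\langle\varphi_1,\dots,\varphi_d\rangle$ is the group of birational transformations they generate. Group $H$: with $(e_i)$ the canonical basis of $\mathbb R^d$ and $u_i=\Delta^{1/2}e_i$, let $H_i=\langle u_i\rangle^\perp$ (for the standard scalar product), $r_i$ the orthogonal reflection with respect to the hyperplane $H_i$, and $H=\langle r_1,\dots,r_d\rangle\subset O(d)$. *)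

(* Defs.v *)
From HB Require Import structures.
From mathcomp Require Import all_boot all_order all_algebra fraction.
From mathcomp Require Import finmap mpoly.
From mathcomp Require Import boolp classical_sets cardinality reals.
From mathcomp Require Import topology normedtype derive.
Set Implicit Arguments.
Unset Strict Implicit.
Unset Printing Implicit Defensive.
Import Order.TTheory GRing.Theory Num.Theory.
Import numFieldNormedType.Exports.
Local Open Scope fset_scope.
Local Open Scope ring_scope.

(* Points and steps of Z^d are row vectors of integers, points of R^d at      *)
(* which chi is evaluated are row vectors, and the vectors on which H acts    *)
(* are column vectors.                                                        *)

(* The subgroup generated by the family [gen] inside the invertible elements  *)
(* of the monoid (T, op, e).                                                  *)
Inductive generated (T I : Type) (op : T -> T -> T) (e : T) (gen : I -> T) :
  T -> Prop :=
| generated_one : generated op e gen e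
| generated_gen i : generated op e gen (gen i)
| generated_mul x y : generated op e gen x -> generated op e gen y ->
    generated op e gen (op x y)
| generated_inv x y : generated op e gen x -> op x y = e -> op y x = e ->
    generated op e gen y.

Section Walks.
Variables (R : realType) (d : nat).
Implicit Types (S : {fset 'rV[int]_d}) (w : 'rV[int]_d -> R).
Implicit Types (P Q : 'rV[int]_d).

Definition small_steps S : Prop :=
  forall s, s \in S -> forall i, s 0 i \in [:: -1; 0; 1].

(* Only the values of [w] on [S] matter. *)
Definition weighting S w : Prop :=
  (forall s, s \in S -> 0 < w s) /\ \sum_(s <- S) w s = 1.

Definition in_orthant P : bool := [forall i, 0 <= P 0 i].

(* Position after the first [k] of the [n] steps [t]. *)
Definition walk_pos S P n (t : n.-tuple S) (k : nat) : 'rV[int]_d :=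
  P + \sum_(j < n | (j < k)%N) val (tnth t j).

Definition is_walk S P Q n (t : n.-tuple S) : bool :=
  [forall k : 'I_n.+1, in_orthant (walk_pos P t k)] && (walk_pos P t n == Q).

Definition e_C S w P Q n : R :=
  \sum_(t : n.-tuple S | is_walk P Q t) \prod_(k < n) w (val (tnth t k)).

Definition irreducible_in_orthant S w : Prop :=
  forall P Q, in_orthant P -> in_orthant Q ->
    exists n, (1 <= n)%N /\ e_C S w P Q n != 0.

End Walks.

Section Inventory.
Variables (R : realType) (d : nat).
Implicit Types (S : {fset 'rV[int]_d}) (w : 'rV[int]_d -> R).
Implicit Types (f : 'rV[R]_d -> R) (x : 'rV[R]_d).

Definition inventory S w : 'rV[R]_d -> R :=
  fun x => \sum_(s <- S) w s * \prod_i x 0 i ^ s 0 i.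

Definition partial (i : 'I_d) f : 'rV[R]_d -> R :=
  fun x => 'D_(delta_mx 0 i) f x.

Definition critical_point S w x : Prop :=
  (forall i, 0 < x 0 i) /\ (forall i, partial i (inventory S w) x = 0).

Definition covariance S w x : 'M[R]_d :=
  let chi := inventory S w in
  \matrix_(i, j) (partial i (partial j chi) x /
    Num.sqrt (partial i (partial i chi) x * partial j (partial j chi) x)).

End Inventory.

Section BirationalGroup.
Variables (R : realType) (d : nat).
Implicit Types (S : {fset 'rV[int]_d}) (w : 'rV[int]_d -> R).

Definition ratfun := {fraction {mpoly R[d]}}.

Definition rat_const (c : R) : ratfun := tofrac (c%:MP : {mpoly R[d]}).
Definition rat_var (i : 'I_d) : ratfun := tofrac ('X_i : {mpoly R[d]}).

(* A birational transformation of affine d-space is given by the d-tuple of   *)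
(* its coordinate functions.                                                  *)
Definition ratmap := {ffun 'I_d -> ratfun}.

Definition mpoly_subst (f : ratmap) (p : {mpoly R[d]}) : ratfun :=
  mmap rat_const f p.

(* r(f_1, ..., f_d), computed on the chosen representative of the fraction r. *)
(* When f is dominant (in particular birational) no nonzero polynomial        *)
(* vanishes at f, so that the result does not depend on this representative.  *)
Definition rat_subst (f : ratmap) (r : ratfun) : ratfun :=
  mpoly_subst f (repr r : {ratio {mpoly R[d]}}).1 /
  mpoly_subst f (repr r : {ratio {mpoly R[d]}}).2.

Definition ratmap_id : ratmap := [ffun i => rat_var i].
Definition ratmap_comp (g f : ratmap) : ratmap := [ffun i => rat_subst f (g i)].

(* The coefficient of x_i ^ a in chi, a Laurent polynomial not involving x_i: *)
(* A_i, B_i, C_i are obtained for a = 1, 0, -1.                               *)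
Definition inventory_coef S w (i : 'I_d) (a : int) : ratfun :=
  \sum_(s <- S | s 0 i == a)
    rat_const (w s) * \prod_(j | j != i) rat_var j ^ s 0 j.

Definition phi S w (i : 'I_d) : ratmap :=
  [ffun j => if j == i then
               (rat_var i)^-1 *
                 (inventory_coef S w i (-1) / inventory_coef S w i 1)
             else rat_var j].

Definition groupG S w : set ratmap :=
  generated ratmap_comp ratmap_id (phi S w).

Definition rat_inventory S w : ratfun :=
  \sum_(s <- S) rat_const (w s) * \prod_i rat_var i ^ s 0 i.

Lemma rat_var_neq0 i : rat_var i != 0.
Proof.
rewrite /rat_var tofrac_eq0; apply/eqP => /(congr1 (mcoeff U_(i))).
by rewrite mcoeffX eqxx mcoeff0 => /eqP; rewrite oner_eq0.
Qed.

Lemma rat_inventoryE S w i : small_steps S ->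
  rat_inventory S w =
    rat_var i * inventory_coef S w i 1 + inventory_coef S w i 0
    + (rat_var i)^-1 * inventory_coef S w i (-1).
Proof.
move=> hS; have E a : \sum_(s <- S | s 0 i == a)
    rat_const (w s) * \prod_j rat_var j ^ s 0 j =
    rat_var i ^ a * inventory_coef S w i a.
  rewrite /inventory_coef mulr_sumr; apply: eq_bigr => s /eqP sa.
  by rewrite (bigD1 i) //= sa mulrCA.
rewrite -[X in _ = X * _ + _ + _]expr1z -[X in _ = _ + X + _]mul1r.
rewrite -[X in _ = _ + X * _ + _](expr0z (rat_var i)) -exprN1.
rewrite -[X in _ = _ + _ + X]E -[X in _ = _ + X + _]E -[X in _ = X + _ + _]E.
rewrite /rat_inventory (bigID (fun s : 'rV[int]_d => s 0 i == 1)) /=.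
rewrite -addrA; congr (_ + _).
rewrite (bigID (fun s : 'rV[int]_d => s 0 i == 0)) /=; congr (_ + _).
- apply: eq_bigl => s; case: (eqVneq (s 0 i) 0) => [->|] //=.
  by rewrite andbF.
- rewrite big_seq_cond [RHS]big_seq_cond; apply: eq_bigl => s.
  case sS: (s \in S) => //=; move: (hS s sS i).
  by rewrite !inE => /or3P[] /eqP ->.
Qed.

End BirationalGroup.

Section ReflectionGroup.
Variables (R : realType) (d : nat).
Implicit Types (u v : 'cV[R]_d) (M N : 'M[R]_d).

Definition dotprod u v : R := (u^T *m v) 0 0.

Definition sym_posdef M : Prop :=
  M^T = M /\ forall v, v != 0 -> 0 < dotprod v (M *m v).

Definition is_sym_posdef_sqrt N M : Prop := sym_posdef N /\ N *m N = M.

(* The matrix, acting on column vectors, of the orthogonal reflection with    *)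
(* respect to the hyperplane orthogonal to u.                                 *)
Definition reflection u : 'M[R]_d :=
  1%:M - (2 / dotprod u u) *: (u *m u^T).

Lemma reflectionE u v :
  reflection u *m v = v - (2 * dotprod u v / dotprod u u) *: u.
Proof.
rewrite /reflection mulmxBl mul1mx -scalemxAl -mulmxA.
rewrite [u^T *m v]mx11_scalar mul_mx_scalar scalerA; congr (_ - _ *: _).
by rewrite /dotprod mulrAC.
Qed.

Definition reflection_r N (i : 'I_d) : 'M[R]_d :=
  reflection (N *m delta_mx i 0).

(* [N] stands for Delta^(1/2). *)
Definition groupH N : set 'M[R]_d :=
  generated mulmx 1%:M (reflection_r N).

End ReflectionGroup.

(* Main.v *)
(* Each phi_i preserves the open positive orthant and fixes the critical point
   x0, where its differential is v |-> v - 2 (a v)_i / a_ii e_i, a being the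
   Hessian of the inventory: this is the reflection in e_i for the scalar
   product a.  Since a = D Delta D with D diagonal, conjugation by
   Delta^(1/2) D turns it into r_i.  By the chain rule, a word in the r_i is
   conjugate to the differential at x0 of the corresponding word in the phi_i,
   so it depends only on an element of G.  Composing representatives of
   rational functions is harmless because an involution of the orthant cannot
   annihilate a nonzero polynomial. *)
Require Import Defs.
From HB Require Import structures.
From mathcomp Require Import all_boot all_order all_algebra.
From mathcomp Require Import fraction generic_quotient.
From mathcomp Require Import finmap mpoly ring.
From mathcomp Require Import boolp classical_sets cardinality reals.
From mathcomp Require Import topology normedtype derive.
Set Implicit Arguments.
Unset Strict Implicit.
Unset Printing Implicit Defensive.
Import Order.TTheory GRing.Theory Num.Theory.
Import numFieldNormedType.Exports.
Local Open Scope ring_scope.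

(** * Representatives of fractions and words in involutions *)

(** [rat_subst] computes on [repr r]; this identity allows that representative to be compared with
    any other way of writing [r] as a quotient. *)
Lemma fractionE (D : idomainType) (r : {fraction D}) :
  r = tofrac (repr r : {ratio D}).1 / tofrac (repr r : {ratio D}).2.
Proof.
set t := repr r; rewrite -[LHS]reprK -/t; unlock tofrac.
rewrite -[X in _ = _ * X]FracField.pi_inv -[RHS]FracField.pi_mul.
rewrite /FracField.mulf /FracField.invf /=.
rewrite !numden_Ratio ?oner_neq0 ?denom_ratioP// mulr1 mul1r.
by rewrite Ratio_numden.
Qed.

(** The inverse of a word in involutions is the reversed word, so closing under inverses adds
    nothing to the set of words. *)
Lemma generated_involutions (R : pzRingType) n (I : Type)
    (gen : I -> 'M[R]_n) h :
  (forall i, gen i *m gen i = 1%:M) -> generated mulmx 1%:M gen h ->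
  exists l, h = foldr (fun i M => gen i *m M) 1%:M l.
Proof.
move=> gen2; pose word := foldr (fun i M => gen i *m M) 1%:M.
have word_cat l1 l2 : word (l1 ++ l2) = word l1 *m word l2.
  by elim: l1 => [|i l1 /= ->]; rewrite ?mul1mx ?mulmxA.
have word_rev l : word (rev l) *m word l = 1%:M.
  elim: l => [|i l IHl]; first by rewrite mulmx1.
  rewrite rev_cons -cats1 word_cat /= mulmx1 -mulmxA.
  by rewrite [gen i *m (_ *m _)]mulmxA gen2 mul1mx.
elim=> {h} [|i|g h _ [l1 ->] _ [l2 ->]|g h _ [l ->] lg _].
- by exists [::].
- by exists [:: i]; rewrite /= mulmx1.
- by exists (l1 ++ l2); rewrite -/word word_cat.
by exists (rev l); rewrite -/word -[LHS]mul1mx -(word_rev l) -mulmxA lg mulmx1.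
Qed.

Lemma reflectionK (R : realType) n (u : 'cV[R]_n) :
  dotprod u u != 0 -> reflection u *m reflection u = 1%:M.
Proof.
move=> u0; rewrite {2}/reflection mulmxBr mulmx1 -scalemxAr mulmxA reflectionE.
rewrite mulfK// scaler_nat mulr2n opprD addNKr mulNmx scalerN opprK.
by rewrite /reflection subrK.
Qed.

(** * Rational functions as functions on the positive orthant *)

Section Orthant.
Variables (R : realType) (d : nat).
Implicit Types (x : 'rV[R]_d) (F G : 'rV[R]_d -> R) (r : ratfun R d).

Definition orthant : set 'rV[R]_d := [set x | forall i, 0 < x 0 i]%classic.

Lemma orthant1 : orthant (const_mx 1).
Proof. by move=> i; rewrite mxE. Qed.

(* Dedekind's independence of characters: if two exponents m, m' differ at j,
   comparing values at x and at x with x_j doubled eliminates m but not m'. *)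
Lemma monomials_free (s : seq 'X_{1..d}) (c : 'X_{1..d} -> R) :
  uniq s -> (forall m, m \in s -> c m != 0) ->
  (forall x, orthant x -> \sum_(m <- s) c m * \prod_i x 0 i ^+ m i = 0) ->
  s = [::].
Proof.
have [n] := ubnP (size s); elim: n s c => // n IHn [//|m [|m' s]] c.
  move=> _ _ cN0 /(_ _ orthant1); rewrite big_seq1 big1 ?mulr1 => [/eqP|i _].
    by rewrite (negPf (cN0 m _)) ?mem_head.
  by rewrite mxE expr1n.
rewrite ltnS => ltsn us cN0 s0; exfalso.
have [j mj] : exists j, m j != m' j.
  apply/existsP; apply: contraT; rewrite negb_exists => /forallP mm'.
  move: us; rewrite /= inE; suff -> : m = m' by rewrite eqxx.
  by apply/mnmP => j; have := mm' j; rewrite negbK => /eqP.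
(* All exponents that agree with [m] at [j] cancel together, so the list gets shorter; [m']
   survives, which contradicts the emptiness given by induction. *)
pose t := [seq k : 'X_{1..d} <- [:: m, m' & s] | k j != m j].
suff /(congr1 (fun s => m' \in s)) : t = [::].
  by rewrite mem_filter !inE eqxx orbT eq_sym mj.
apply: (IHn _ (fun k => c k * (2 ^+ k j - 2 ^+ m j))).
- rewrite size_filter /= eqxx add0n; apply: leq_trans ltsn.
  by rewrite ltnS -[(size s).+1]add1n leq_add ?leq_b1 ?count_size.
- exact: filter_uniq.
- move=> k; rewrite mem_filter => /andP[kj ks].
  rewrite mulf_neq0 ?cN0// subr_eq0; apply: contra kj => /eqP.
  by move=> /(ieexprIn (ltr0n R 2)) ->//; rewrite pnatr_eq1.
move=> x x0.
pose y : 'rV_d := \row_i (x 0 i * (if i == j then 2 else 1)).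
have y0 : orthant y.
  by move=> i; rewrite mxE mulr_gt0//; case: eqP.
transitivity (\sum_(k <- [:: m, m' & s]) c k * \prod_i y 0 i ^+ k i -
  2 ^+ m j * \sum_(k <- [:: m, m' & s]) c k * \prod_i x 0 i ^+ k i); last first.
  by rewrite !s0// mulr0 subr0.
rewrite big_filter big_mkcond mulr_sumr -sumrB; apply: eq_bigr => k _.
have -> : \prod_i y 0 i ^+ k i = 2 ^+ k j * \prod_i x 0 i ^+ k i.
  rewrite (bigD1 j)//= [in RHS](bigD1 j)//= mxE eqxx exprMn mulrA.
  rewrite [x 0 j ^+ _ * _]mulrC; congr (_ * _).
  by apply: eq_bigr => i /negPf ij; rewrite mxE ij mulr1.
case: eqP => [->|_] /=; first by rewrite mulrCA subrr.
by rewrite mulrBr mulrBl mulrA [2 ^+ m j * _]mulrCA !mulrA.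
Qed.

(** The support of [p] lists distinct exponents with nonzero coefficients, so [monomials_free]
    forces it to be empty. *)
Lemma meval_orthant_eq0 (p : {mpoly R[d]}) :
  (forall x, orthant x -> p.@[x 0] = 0) -> p = 0.
Proof.
move=> p0; apply/eqP; rewrite -msupp_eq0; apply/eqP.
apply: (@monomials_free _ (fun m => p@_m)) => //.
by move=> m; rewrite mcoeff_msupp.
Qed.

(* The function F on the orthant is the value of a fraction equal to r whose
   denominator is positive there; nothing is said about F elsewhere. *)
Definition represents r F : Prop :=
  exists p q : {mpoly R[d]}, r = tofrac p / tofrac q /\
    forall x, orthant x -> 0 < q.@[x 0] /\ F x = p.@[x 0] / q.@[x 0].

Lemma orthant_pos_neq0 (q : {mpoly R[d]}) :
  (forall x, orthant x -> 0 < q.@[x 0]) -> q != 0.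
Proof.
by move=> /(_ _ orthant1); apply: contraTneq => ->; rewrite meval0 ltxx.
Qed.

(** Equality of the fractions is a polynomial identity after cross-multiplication, and its values
    can be divided back because both denominators are positive on the orthant. *)
Lemma represents_inj r F G x :
  represents r F -> represents r G -> orthant x -> F x = G x.
Proof.
move=> [p [q [-> Fpq]]] [p' [q' [eqpq Gpq]]] x0.
have q0 : q != 0 by apply: orthant_pos_neq0 => y /Fpq[].
have q'0 : q' != 0 by apply: orthant_pos_neq0 => y /Gpq[].
have [qx ->] := Fpq _ x0; have [q'x ->] := Gpq _ x0.
apply/eqP; rewrite eqr_div ?lt0r_neq0// -!mevalM.
suff -> : p * q' = p' * q by [].
apply/eqP; rewrite -tofrac_eq !tofracM -eqr_div ?tofrac_eq0//.
by rewrite eqpq.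
Qed.

Lemma represents_ext r F G :
  (forall x, orthant x -> F x = G x) -> represents r F -> represents r G.
Proof.
move=> FG [p [q [-> Fpq]]]; exists p, q; split=> // x x0.
by rewrite -FG//; apply: Fpq.
Qed.

Lemma represents_tofrac (p : {mpoly R[d]}) :
  represents (tofrac p) (fun x => p.@[x 0]).
Proof.
exists p, 1; rewrite tofrac1 divr1; split=> // x _.
by rewrite meval1 divr1.
Qed.

Lemma represents_const c : represents (rat_const d c) (fun=> c).
Proof.
by apply: represents_ext (represents_tofrac _) => x _; rewrite mevalC.
Qed.

Lemma represents_var i : represents (rat_var R i) (fun x => x 0 i).
Proof.
by apply: represents_ext (represents_tofrac _) => x _; rewrite mevalXU.
Qed.

Lemma representsD r r' F G : represents r F -> represents r' G ->
  represents (r + r') (fun x => F x + G x).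
Proof.
move=> [p [q [-> Fpq]]] [p' [q' [-> Gpq]]].
have q0 : q != 0 by apply: orthant_pos_neq0 => y /Fpq[].
have q'0 : q' != 0 by apply: orthant_pos_neq0 => y /Gpq[].
exists (p * q' + p' * q), (q * q'); split.
  by rewrite addf_div ?tofrac_eq0// !tofracD !tofracM.
move=> x x0; have [qx ->] := Fpq _ x0; have [q'x ->] := Gpq _ x0.
by rewrite mevalD !mevalM mulr_gt0// addf_div// lt0r_neq0.
Qed.

Lemma representsM r r' F G : represents r F -> represents r' G ->
  represents (r * r') (fun x => F x * G x).
Proof.
move=> [p [q [-> Fpq]]] [p' [q' [-> Gpq]]].
exists (p * p'), (q * q'); split; first by rewrite mulf_div !tofracM.
move=> x x0; have [qx ->] := Fpq _ x0; have [q'x ->] := Gpq _ x0.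
by rewrite !mevalM mulr_gt0// mulf_div.
Qed.

(** Positivity of [F] makes the numerator positive on the orthant, so it can serve as the new
    denominator. *)
Lemma representsV r F : (forall x, orthant x -> 0 < F x) ->
  represents r F -> represents r^-1 (fun x => (F x)^-1).
Proof.
move=> F0 [p [q [-> Fpq]]]; exists q, p; split; first by rewrite invf_div.
move=> x x0; have [qx Fx] := Fpq _ x0; rewrite Fx invf_div; split=> //.
by have := F0 _ x0; rewrite Fx pmulr_lgt0// invr_gt0.
Qed.

Lemma represents_sum (I : Type) (s : seq I) (P : pred I)
    (r : I -> ratfun R d) (F : I -> 'rV[R]_d -> R) :
  (forall k, P k -> represents (r k) (F k)) ->
  represents (\sum_(k <- s | P k) r k) (fun x => \sum_(k <- s | P k) F k x).
Proof.
move=> rF; elim: s => [|k s IHs].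
  rewrite big_nil -[0]tofrac0.
  by apply: represents_ext (represents_tofrac _) => x _; rewrite big_nil meval0.
rewrite big_cons; case Pk: (P k); last first.
  by apply: represents_ext IHs => x _; rewrite big_cons Pk.
apply: represents_ext (representsD (rF k Pk) IHs) => x _.
by rewrite big_cons Pk.
Qed.

Lemma represents_prod (I : Type) (s : seq I) (P : pred I)
    (r : I -> ratfun R d) (F : I -> 'rV[R]_d -> R) :
  (forall k, P k -> represents (r k) (F k)) ->
  represents (\prod_(k <- s | P k) r k) (fun x => \prod_(k <- s | P k) F k x).
Proof.
move=> rF; elim: s => [|k s IHs].
  rewrite big_nil -[1]tofrac1.
  by apply: represents_ext (represents_tofrac _) => x _; rewrite big_nil meval1.
rewrite big_cons; case Pk: (P k); last first.
  by apply: represents_ext IHs => x _; rewrite big_cons Pk.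
apply: represents_ext (representsM (rF k Pk) IHs) => x _.
by rewrite big_cons Pk.
Qed.

Lemma representsX n r F :
  represents r F -> represents (r ^+ n) (fun x => F x ^+ n).
Proof.
move=> rF; elim: n => [|n IHn].
  exact: represents_ext (represents_const 1).
rewrite exprS; apply: represents_ext (representsM rF IHn) => x _.
by rewrite exprS.
Qed.

Lemma represents_varXz i (a : int) :
  represents (rat_var R i ^ a) (fun x => x 0 i ^ a).
Proof.
case: a => n; first exact/representsX/represents_var.
apply: representsV => [x x0|]; first exact: exprn_gt0.
exact/representsX/represents_var.
Qed.

(** * Substituting an involution of the orthant into a fraction *)

Section Substitution.
Variables (f : ratmap R d) (Phi : 'rV[R]_d -> 'rV[R]_d).
Hypothesis fPhi : forall j, represents (f j) (fun x => Phi x 0 j).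

Lemma represents_mpoly_subst p :
  represents (mpoly_subst f p) (fun x => p.@[Phi x 0]).
Proof.
rewrite /mpoly_subst /mmap.
apply: represents_ext (_ : represents _ (fun x => \sum_(m <- msupp p)
  p@_m * \prod_i Phi x 0 i ^+ m i)); first by [].
apply: represents_sum => m _; apply: representsM (represents_const _) _.
by apply: represents_prod => i _; apply: representsX.
Qed.

Lemma mpoly_substM : {morph mpoly_subst f : p q / p * q}.
Proof.
have [fM _] := mmap_is_multiplicative f (@tofrac _ \o @mpolyC d R).
exact: fM.
Qed.

Hypothesis PhiO : forall x, orthant x -> orthant (Phi x).
Hypothesis PhiK : forall x, orthant x -> Phi (Phi x) = x.

(** If the substituted polynomial is zero, [p] vanishes at every [Phi x] with [x] in the orthant;
    these points fill the orthant because [Phi] is an involution of it. *)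
Lemma mpoly_subst_neq0 p : p != 0 -> mpoly_subst f p != 0.
Proof.
apply: contraNneq => p0; apply/eqP/meval_orthant_eq0 => x x0.
have := represents_mpoly_subst p; rewrite p0 -tofrac0 => rp.
have := represents_inj rp (represents_tofrac 0) (PhiO x0).
by rewrite PhiK// meval0.
Qed.

(** Two representatives of [r] satisfy [n * q = p * e]. Substitution is multiplicative and keeps
    denominators nonzero, so the quotient may be computed from [p] and [q], whose denominator is
    positive at [Phi x]. *)
Lemma represents_rat_subst r F :
  represents r F -> represents (rat_subst f r) (F \o Phi).
Proof.
move=> [p [q [rpq Fpq]]].
have q0 : q != 0 by apply: orthant_pos_neq0 => y /Fpq[].
have := fractionE r; rewrite /rat_subst; set n := _.1; set e := _.2 => rne.
have e0 : e != 0 by apply: denom_ratioP.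
have -> : mpoly_subst f n / mpoly_subst f e =
    mpoly_subst f p / mpoly_subst f q.
  apply/eqP; rewrite eqr_div ?mpoly_subst_neq0// -!mpoly_substM.
  suff -> : n * q = p * e by [].
  by apply/eqP; rewrite -tofrac_eq !tofracM -eqr_div ?tofrac_eq0// -rne -rpq.
apply: represents_ext (_ : represents _
  (fun x => p.@[Phi x 0] * (q.@[Phi x 0])^-1)) => [x x0|].
  by have [_ /= ->] := Fpq _ (PhiO x0).
apply: representsM (represents_mpoly_subst _) (representsV _ _) => [x x0|].
  by have [] := Fpq _ (PhiO x0).
exact: represents_mpoly_subst.
Qed.

End Substitution.
End Orthant.

(** * The maps phi_i as involutions of the orthant *)

Section Involution.
Variables (R : realType) (d : nat) (S : {fset 'rV[int]_d}).
Variable w : 'rV[int]_d -> R.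
Implicit Types (x : 'rV[R]_d) (s : 'rV[int]_d) (i : 'I_d).

Definition monomial s x : R := \prod_i x 0 i ^ s 0 i.

Definition slice i (a : int) x : R :=
  \sum_(s <- S | s 0 i == a) w s * monomial s x.

(* On the orthant, x_i times A_i is the slice 1 and C_i / x_i the slice -1. *)
Definition phi_fun i x : 'rV[R]_d :=
  x + (x 0 i * (slice i (-1) x / slice i 1 x) - x 0 i) *: delta_mx 0 i.

Lemma phi_funE i x j : phi_fun i x 0 j =
  if j == i then x 0 i * (slice i (-1) x / slice i 1 x) else x 0 j.
Proof.
rewrite !mxE eqxx /=; case: eqP => [->|_] /=; last by rewrite mulr0 addr0.
by rewrite mulr1 subrKC.
Qed.

Lemma monomial_gt0 s x : orthant x -> 0 < monomial s x.
Proof. by move=> x0; apply: prodr_gt0 => i _; apply: exprz_gt0. Qed.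

Let pos1 : 1 \in [:: 1; -1 : int]. Proof. exact: mem_head. Qed.
Let neg1 : -1 \in [:: 1; -1 : int]. Proof. by rewrite !inE eqxx orbT. Qed.

Hypothesis wS : weighting S w.
Hypothesis steps : forall i (a : int), a \in [:: 1; -1] ->
  exists2 s, s \in S & s 0 i = a.

(** One step with [i]-th coordinate [a] gives a positive term and the others cannot be negative.
    This keeps the quotient in [phi_fun] well defined and positive. *)
Lemma slice_gt0 i a x : a \in [:: 1; -1] -> orthant x -> 0 < slice i a x.
Proof.
move=> /(steps i)[s sS sia] x0; have [w0 _] := wS.
have pos t : t \in S -> 0 < w t * monomial t x.
  by move=> tS; rewrite mulr_gt0 ?w0 ?monomial_gt0.
rewrite /slice big_seq_cond (big_rem s)//= sS sia eqxx /=.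
rewrite ltr_wpDr ?pos// sumr_ge0// => t /andP[tS _].
by rewrite ltW ?pos.
Qed.

Lemma monomial_phi i s x : orthant x -> monomial s (phi_fun i x) =
  (slice i (-1) x / slice i 1 x) ^ s 0 i * monomial s x.
Proof.
move=> x0; rewrite /monomial (bigD1 i)//= [in RHS](bigD1 i)//=.
rewrite phi_funE eqxx expfzMl mulrA [_ ^ _ * _ ^ _]mulrC; congr (_ * _).
by apply: eq_bigr => j /negPf ji; rewrite phi_funE ji.
Qed.

(** Since [phi_fun] multiplies x_i by the ratio of the slices -1 and 1, it exchanges these two
    slices; hence it is an involution. *)
Lemma slice_phi i a x : orthant x -> slice i a (phi_fun i x) =
  (slice i (-1) x / slice i 1 x) ^ a * slice i a x.
Proof.
move=> x0; rewrite [in RHS]/slice mulr_sumr; apply: eq_bigr => s /eqP sia.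
by rewrite monomial_phi// sia mulrCA.
Qed.

Lemma phi_fun_orthant i x : orthant x -> orthant (phi_fun i x).
Proof.
move=> x0 j; rewrite phi_funE; case: ifP => // _.
by rewrite mulr_gt0 ?divr_gt0 ?slice_gt0.
Qed.

Lemma phi_funK i x : orthant x -> phi_fun i (phi_fun i x) = x.
Proof.
move=> x0; apply/rowP => j; rewrite !phi_funE !slice_phi// eqxx.
case: eqP => // ->; have P := slice_gt0 i pos1 x0.
have N := slice_gt0 i neg1 x0.
by rewrite exprN1 expr1z; field; rewrite !lt0r_neq0.
Qed.

Lemma represents_inventory_coef i a : represents (inventory_coef S w i a)
  (fun x => x 0 i ^ (- a) * slice i a x).
Proof.
apply: represents_ext (_ : represents _ (fun x => \sum_(s <- S | s 0 i == a)
  w s * \prod_(j | j != i) x 0 j ^ s 0 j)) => [x x0|].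
  rewrite mulr_sumr; apply: eq_bigr => s /eqP sia.
  rewrite [in RHS]/monomial [in RHS](bigD1 i)//= sia mulrCA; congr (_ * _).
  by rewrite mulrA -expfzDr ?lt0r_neq0// addNr expr0z mul1r.
apply: represents_sum => s _; apply: representsM (represents_const _ _) _.
by apply: represents_prod => j _; apply: represents_varXz.
Qed.

Lemma represents_phi i j :
  represents (phi S w i j) (fun x => phi_fun i x 0 j).
Proof.
rewrite ffunE; case: ifP => [/eqP ->|ji]; last first.
  apply: represents_ext (represents_var _ _) => x _.
  by rewrite phi_funE ji.
have coef_gt0 a : a \in [:: 1; -1] ->
    forall x, orthant x -> 0 < x 0 i ^ (- a) * slice i a x.
  by move=> a1 x x0; rewrite mulr_gt0 ?exprz_gt0 ?slice_gt0.
apply: represents_ext (representsM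
  (representsV _ (represents_var _ i))
  (representsM (represents_inventory_coef i (-1))
    (representsV (coef_gt0 _ pos1) (represents_inventory_coef i 1))))
  => [x x0|x /(_ i)//].
rewrite phi_funE eqxx opprK exprN1 expr1z.
have P := slice_gt0 i pos1 x0.
by field; rewrite !lt0r_neq0.
Qed.

(** Each new generator is the inner map of the composition: [represents_rat_subst] needs the
    substituted map to be an involution, which a generator is and a general word is not. *)
Definition phi_word (l : seq 'I_d) : ratmap R d :=
  foldr (fun i g => ratmap_comp g (phi S w i)) (ratmap_id R d) l.

Definition phi_word_fun (l : seq 'I_d) : 'rV[R]_d -> 'rV[R]_d :=
  foldr (fun i F => F \o phi_fun i) id l.

Lemma represents_phi_word l j :
  represents (phi_word l j) (fun x => phi_word_fun l x 0 j).
Proof.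
elim: l => [|i l IHl] /=; first by rewrite ffunE; apply: represents_var.
rewrite ffunE; apply: (represents_rat_subst (Phi := phi_fun i) _ _ _ IHl).
- exact: represents_phi.
- exact: phi_fun_orthant.
- exact: phi_funK.
Qed.

Lemma phi_word_in_groupG l : groupG S w (phi_word l).
Proof.
by elim: l => [|i l IHl]; constructor=> //; constructor.
Qed.
End Involution.

(** * Irreducibility provides steps in both directions along each axis *)

Section Steps.
Variables (R : realType) (d : nat) (S : {fset 'rV[int]_d}).
Variable w : 'rV[int]_d -> R.

(** Without such a step, smallness leaves only the coordinates 0 and [- a], so [a] times each
    coordinate is at most 0, whereas these products add up to [a * a = 1]. *)
Lemma walk_step (P Q : 'rV[int]_d) n (t : n.-tuple S) i (a : int) :
  small_steps S -> is_walk P Q t -> a \in [:: 1; -1] -> Q 0 i - P 0 i = a ->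
  exists2 s, s \in S & s 0 i = a.
Proof.
move=> small /andP[_ /eqP <-] a1; rewrite /walk_pos mxE addrAC.
rewrite subrr add0r summxE.
apply: contraPP => noa sa.
have le0 (k : 'I_n) : a * (val (tnth t k)) 0 i <= 0.
  have sS : val (tnth t k) \in S by apply: valP.
  move: (small _ sS i) noa a1; set b := _ 0 i; rewrite !inE => hb noa.
  have ba : b != a by apply/eqP => ba; apply: noa; exists (val (tnth t k)).
  by move=> /orP[] /eqP aE; move: hb ba; rewrite aE => /or3P[] /eqP ->.
have : \sum_(k < n) a * (val (tnth t k)) 0 i <= 0 by apply: sumr_le0.
rewrite -mulr_sumr.
have -> : \sum_(k < n) (val (tnth t k)) 0 i = a.
  by rewrite -[RHS]sa; apply: eq_bigl => k; rewrite ltn_ord.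
by move: a1; rewrite !inE => /orP[] /eqP ->.
Qed.

(** A walk from the origin to the [i]-th unit vector needs a step with coordinate 1, and a walk back
    needs one with coordinate -1. *)
Lemma irreducible_step i (a : int) : small_steps S ->
  irreducible_in_orthant S w -> a \in [:: 1; -1] ->
  exists2 s, s \in S & s 0 i = a.
Proof.
move=> small irr a1.
have walk (P Q : 'rV[int]_d) : in_orthant P -> in_orthant Q ->
    Q 0 i - P 0 i = a -> exists2 s, s \in S & s 0 i = a.
  move=> P0 Q0 PQ; have [n [_]] := irr P Q P0 Q0.
  apply: contraNP => nos; apply/eqP; rewrite /e_C big_pred0// => t.
  by apply/negP => /walk_step - /(_ i a small a1 PQ).
have in0 : in_orthant (0 : 'rV[int]_d) by apply/forallP => j; rewrite mxE.
have ini : in_orthant (delta_mx 0 i : 'rV[int]_d).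
  by apply/forallP => j; rewrite mxE; case: (_ && _).
move: a1; rewrite !inE => /orP[] /eqP aE.
  by apply: walk in0 ini _; rewrite !mxE !eqxx aE.
by apply: walk ini in0 _; rewrite !mxE !eqxx aE.
Qed.
End Steps.

(** * Rules of differentiation in logarithmic form *)

Section Differentials.
Variables (R : realType) (V : normedModType R).
Implicit Types (f df : V -> R) (x v : V).

Lemma is_diff_ext (W : normedModType R) (f g df dg : V -> W) x :
  f =1 g -> df =1 dg -> is_diff x f df -> is_diff x g dg.
Proof. by move=> /funext -> /funext ->. Qed.

Lemma is_diff_derive (W : normedModType R) (f df : V -> W) x v :
  is_diff x f df -> 'D_v f x = df v.
Proof. by move=> fdf; rewrite deriveE ?diff_val//; apply: ex_diff. Qed.

Lemma is_diff_const (c : R) x : is_diff x (fun=> c) (fun=> 0).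
Proof. exact: is_diff_cst. Qed.

Lemma is_diff_mul f g df dg x : is_diff x f df -> is_diff x g dg ->
  is_diff x (fun y => f y * g y) (fun v => f x * dg v + g x * df v).
Proof. by move=> fdf gdg; apply: is_diffM. Qed.

Lemma is_diff_add f g df dg x : is_diff x f df -> is_diff x g dg ->
  is_diff x (fun y => f y + g y) (fun v => df v + dg v).
Proof. by move=> fdf gdg; apply: is_diffD. Qed.

Lemma is_diff_scale (W : normedModType R) (u : W) f df x : is_diff x f df ->
  is_diff x (fun y => f y *: u) (fun v => df v *: u).
Proof.
move=> fdf; have fd : differentiable f x by apply: ex_diff.
apply: DiffDef; first exact: differentiableZl.
by rewrite diffZl// diff_val.
Qed.

Lemma is_diff_inv f df x : f x != 0 -> is_diff x f df ->
  is_diff x (fun y => (f y)^-1) (fun v => - (df v / f x) / f x).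
Proof.
move=> fx0 fdf; have fd : differentiable f x by apply: ex_diff.
apply: DiffDef; first exact: differentiableV.
rewrite diffV// diff_val; apply/funext => v /=.
by rewrite /GRing.scale /= mulNr mulNr expr2 invfM mulrC mulrA.
Qed.

(** The factor [df v / f x] avoids the exponent [n - 1] and gives a formula that extends unchanged
    to negative exponents. *)
Lemma is_diff_expn f df x n : f x != 0 -> is_diff x f df ->
  is_diff x (fun y => f y ^+ n) (fun v => f x ^+ n * (n%:R * (df v / f x))).
Proof.
move=> fx0 fdf; elim: n => [|n IHn].
  by apply: is_diff_ext (is_diff_const 1 x) => // v; rewrite mul0r mulr0.
apply: is_diff_ext (is_diff_mul fdf IHn) => [y|v]; rewrite exprS//.
by rewrite -natr1; field.
Qed.

Lemma is_diff_exprz f df x (a : int) : f x != 0 -> is_diff x f df ->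
  is_diff x (fun y => f y ^ a) (fun v => f x ^ a * (a%:~R * (df v / f x))).
Proof.
move=> fx0 fdf; case: a => n; first exact: is_diff_expn.
have := is_diff_inv _ (is_diff_expn n.+1 fx0 fdf).
rewrite expf_neq0// => /(_ isT); apply: is_diff_ext => // v.
rewrite -[f x ^ _]/((f x ^+ n.+1)^-1) NegzE mulrNz -pmulrn.
have := expf_neq0 n.+1 fx0; set u := f x ^+ _ => u0.
by field; rewrite fx0 u0.
Qed.

Lemma is_diff_sum (I : Type) (r : seq I) (P : pred I) (f df : I -> V -> R) x :
  (forall k, is_diff x (f k) (df k)) ->
  is_diff x (fun y => \sum_(k <- r | P k) f k y)
    (fun v => \sum_(k <- r | P k) df k v).
Proof.
move=> fdf; elim: r => [|k r IHr].
  by apply: is_diff_ext (is_diff_const 0 x) => y; rewrite big_nil.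
case Pk: (P k); last by apply: is_diff_ext IHr => y; rewrite big_cons Pk.
by apply: is_diff_ext (is_diff_add (fdf k) IHr) => y; rewrite big_cons Pk.
Qed.

(** With [dl] as logarithmic differentials, the product rule becomes a sum and no product with an
    omitted factor appears. *)
Lemma is_diff_prod (I : Type) (r : seq I) (f dl : I -> V -> R) x :
  (forall k, is_diff x (f k) (fun v => f k x * dl k v)) ->
  is_diff x (fun y => \prod_(k <- r) f k y)
    (fun v => (\prod_(k <- r) f k x) * \sum_(k <- r) dl k v).
Proof.
move=> fdf; elim: r => [|k r IHr].
  by apply: is_diff_ext (is_diff_const 1 x) => y; rewrite !big_nil// mulr0.
apply: is_diff_ext (is_diff_mul (fdf k) IHr) => y; rewrite !big_cons//.
by ring.
Qed.
End Differentials.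

(** * The Hessian at the critical point and the differentials of the phi_i *)

Section Tangent.
Variables (R : realType) (d : nat) (S : {fset 'rV[int]_d}).
Variable w : 'rV[int]_d -> R.
Implicit Types (x v : 'rV[R]_d) (s : 'rV[int]_d) (i : 'I_d).

Lemma is_diff_coord i x : is_diff x (fun y => y 0 i) (fun v => v 0 i).
Proof.
apply: DiffDef; first exact: differentiable_coord.
apply/funext => v; rewrite -deriveE; last exact: differentiable_coord.
(* The identity has derivative [v] along [v]; its [i]-th entry is the derivative of the
   coordinate. *)
have /(congr1 (fun M : 'rV[R]_d => M 0 i)) := derive_mx (@derivable_id _ _ x v).
by rewrite derive_id mxE.
Qed.

Lemma near_orthant x : orthant x -> \forall y \near x, orthant y.
Proof.
move=> x0; have := @filter_forall _ 'I_d
  (fun i => [set y : 'rV[R]_d | 0 < y 0 i]%classic) (nbhs x) _; apply => i.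
by apply: cvgr_gt (x0 i); apply: coord_continuous.
Qed.

Definition dlog s x v : R := \sum_j (s 0 j)%:~R * (v 0 j / x 0 j).

Lemma is_diff_monomial s x : orthant x ->
  is_diff x (monomial s) (fun v => monomial s x * dlog s x v).
Proof.
move=> x0; apply: is_diff_prod => j.
by apply: is_diff_exprz (is_diff_coord _ _); apply: lt0r_neq0.
Qed.

Lemma is_diff_weighted (c : 'rV[int]_d -> R) (P : pred 'rV[int]_d) x :
  orthant x ->
  is_diff x (fun y => \sum_(s <- S | P s) c s * monomial s y)
    (fun v => \sum_(s <- S | P s) c s * (monomial s x * dlog s x v)).
Proof.
move=> x0; apply: is_diff_sum => s.
apply: is_diff_ext (is_diff_mul (is_diff_const _ x) (is_diff_monomial s x0)).
  by [].
by move=> v /=; rewrite mulr0 addr0.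
Qed.

Lemma dlog_delta s x i : dlog s x (delta_mx 0 i) = (s 0 i)%:~R / x 0 i.
Proof.
rewrite /dlog (bigD1 i)//= big1 => [|j /negPf ji].
  by rewrite mxE !eqxx mul1r addr0.
by rewrite mxE ji andbF mul0r mulr0.
Qed.

Lemma partial_inventory i x : orthant x -> partial i (inventory S w) x =
  (\sum_(s <- S) w s * (s 0 i)%:~R * monomial s x) / x 0 i.
Proof.
move=> x0; rewrite /partial (is_diff_derive _ (is_diff_weighted w predT x0)).
rewrite mulr_suml; apply: eq_bigr => s _.
by rewrite dlog_delta; ring.
Qed.

Variable x0 : 'rV[R]_d.
Hypothesis crit : critical_point S w x0.
Let x0_gt0 : orthant x0. Proof. by case: crit. Qed.

(* At a critical point the terms of the second derivatives carrying a factor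
   \sum_s w s * s_i * monomial s x0 vanish. *)
Definition hessian : 'M[R]_d :=
  \matrix_(i, j) (\sum_(s <- S)
    w s * monomial s x0 * (s 0 i)%:~R * (s 0 j)%:~R / (x0 0 i * x0 0 j)).

Lemma critical_sum i :
  \sum_(s <- S) w s * (s 0 i)%:~R * monomial s x0 = 0.
Proof.
have [_ /(_ i)] := crit; rewrite partial_inventory// => /eqP.
by rewrite mulf_eq0 invr_eq0 (negPf (lt0r_neq0 (x0_gt0 i))) orbF => /eqP.
Qed.

Lemma partial2_inventory i j :
  partial i (partial j (inventory S w)) x0 = hessian i j.
Proof.
(* The formula for the first derivative is known only on the orthant, a neighbourhood of [x0], which
   suffices to differentiate it there. *)
rewrite [LHS](near_eq_derive (g := fun x =>
  (\sum_(s <- S) w s * (s 0 j)%:~R * monomial s x) * (x 0 j)^-1)); last first.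
  by apply: filterS (near_orthant x0_gt0) => x; apply: partial_inventory.
have xj0 := lt0r_neq0 (x0_gt0 j).
rewrite (is_diff_derive _ (is_diff_mul
  (is_diff_weighted (fun s => w s * (s 0 j)%:~R) predT x0_gt0)
  (is_diff_inv xj0 (is_diff_coord j x0)))).
rewrite critical_sum mul0r add0r mxE mulr_sumr; apply: eq_bigr => s _.
by rewrite dlog_delta; field; rewrite xj0 lt0r_neq0.
Qed.

Hypothesis small : small_steps S.
Hypothesis wS : weighting S w.
Hypothesis steps : forall i (a : int), a \in [:: 1; -1] ->
  exists2 s, s \in S & s 0 i = a.

Let pos1 : 1 \in [:: 1; -1 : int]. Proof. exact: mem_head. Qed.
Let neg1 : -1 \in [:: 1; -1 : int]. Proof. by rewrite !inE eqxx orbT. Qed.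

Lemma sum_small_steps i (F : 'rV[int]_d -> R) (g : int -> R) : g 0 = 0 ->
  \sum_(s <- S) F s * g (s 0 i) =
  (\sum_(s <- S | s 0 i == 1) F s) * g 1 +
  (\sum_(s <- S | s 0 i == -1) F s) * g (-1).
Proof.
move=> g0; rewrite !mulr_suml [X in X + _]big_mkcond [X in _ + X]big_mkcond.
rewrite -big_split big_seq [RHS]big_seq; apply: eq_bigr => s sS /=.
by move: (small sS i); rewrite !inE => /or3P[] /eqP ->;
  rewrite ?g0 ?mulr0 ?addr0 ?add0r.
Qed.

(** The slice 1 minus the slice -1 is x_i times the [i]-th partial derivative of the inventory. *)
Lemma slice_critical i : slice S w i (-1) x0 = slice S w i 1 x0.
Proof.
have := sum_small_steps i (fun s => w s * monomial s x0) (erefl (0%:~R : R)).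
rewrite mulr1 mulrN1 -/(slice S w i 1 x0) -/(slice S w i (-1) x0).
under eq_bigr => s _ do rewrite mulrAC.
by rewrite critical_sum => /esym/subr0_eq.
Qed.

Lemma hessian_diag i :
  hessian i i = 2 * slice S w i 1 x0 / x0 0 i ^+ 2.
Proof.
have xi0 := lt0r_neq0 (x0_gt0 i).
(* With [g] the square, both slices count positively, and they are equal at [x0]; hence the factor
   2. *)
have := sum_small_steps i (fun s => w s * monomial s x0)
  (g := fun a => a%:~R * a%:~R) (mul0r _).
rewrite mulrNN !mulr1.
rewrite -/(slice S w i 1 x0) -/(slice S w i (-1) x0) slice_critical => eqS.
rewrite mxE mulr_natl mulr2n -eqS mulr_suml; apply: eq_bigr => s _.
by rewrite expr2 !mulrA.
Qed.

Lemma hessian_diag_gt0 i : 0 < hessian i i.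
Proof.
by rewrite hessian_diag divr_gt0 ?exprn_gt0 ?mulr_gt0 ?(slice_gt0 wS steps).
Qed.

Lemma phi_fun_critical i : phi_fun S w i x0 = x0.
Proof.
apply/rowP => j; rewrite phi_funE slice_critical divff ?mulr1.
  by case: eqP => [->|].
by rewrite lt0r_neq0 ?(slice_gt0 wS steps).
Qed.

(* Acts on row vectors: the matrix of a composite F \o phi_i is the product of
   tangent i, on the left, with the matrix of F. *)
Definition tangent i : 'M[R]_d :=
  1%:M -
  (2 / hessian i i) *: (hessian *m (delta_mx i 0 : 'cV_d) *m delta_mx 0 i).

(** The left side is the differential of minus x_i times the [i]-th partial derivative. That
    derivative vanishes at [x0], so only its own differential, given by the Hessian, contributes. *)
Lemma dslice_diff i v :
  \sum_(s <- S | s 0 i == -1) w s * (monomial s x0 * dlog s x0 v) -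
  \sum_(s <- S | s 0 i == 1) w s * (monomial s x0 * dlog s x0 v) =
  - x0 0 i * (v *m hessian) 0 i.
Proof.
have := sum_small_steps i (fun s => w s * (monomial s x0 * dlog s x0 v))
  (erefl (0%:~R : R)).
rewrite mulr1 mulrN1 => /(congr1 -%R); rewrite opprB => <-.
rewrite mulNr; congr (- _); rewrite mxE mulr_sumr.
under [RHS]eq_bigr => j _ do rewrite mxE !mulr_sumr.
rewrite exchange_big; apply: eq_bigr => s _ /=.
rewrite /dlog !mulr_sumr mulr_suml; apply: eq_bigr => j _.
by field; rewrite !lt0r_neq0.
Qed.

(** With N and P the slices -1 and 1, the coordinate x_i moves by x_i N / P - x_i. As N = P at [x0],
    the differential of this is x_i (dN - dP) / P, which [dslice_diff] and [hessian_diag] turn into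
    -2 (v a)_i / a_ii, with a the Hessian. *)
Lemma is_diff_phi i : is_diff x0 (phi_fun S w i) (fun v => v *m tangent i).
Proof.
have P0 : slice S w i 1 x0 != 0.
  by rewrite lt0r_neq0 ?(slice_gt0 wS steps).
have xi0 := lt0r_neq0 (x0_gt0 i).
have dx := is_diff_coord i x0.
have dslice a := is_diff_weighted w (fun s => s 0 i == a) x0_gt0.
have dq := is_diff_add (is_diff_mul dx
  (is_diff_mul (dslice (-1)) (is_diff_inv P0 (dslice 1))))
  (is_diff_mul (is_diff_const (-1) x0) dx).
apply: is_diff_ext (is_diffD (is_diff_id x0)
  (is_diff_scale (delta_mx 0 i) dq)) => [y|v] /=.
  by rewrite /phi_fun -[- y 0 i]mulN1r.
rewrite mulmxBr mulmx1 -scalemxAr !mulmxA.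
congr (_ + _); rewrite -colE [col i _]mx11_scalar mul_scalar_mx scalerA.
rewrite -[RHS]scaleNr.
congr (_ *: _).
have := dslice_diff i v.
set dN := \sum_(s <- S | s 0 i == -1) _; set dP := \sum_(s <- S | s 0 i == 1) _.
move=> dNP.
rewrite -[\sum_(s <- S | _) w s * monomial s x0]/(slice S w i (-1) x0).
rewrite slice_critical [col _ _ _ _]mxE hessian_diag.
move: P0; set P := slice _ _ _ _ _ => P0.
have -> : dN = dP - x0 0 i * (v *m hessian) 0 i by rewrite -mulNr -dNP subrKC.
by field; rewrite P0 xi0.
Qed.

Definition tangent_word (l : seq 'I_d) : 'M[R]_d :=
  foldr (fun i M => tangent i *m M) 1%:M l.

(** Every generator fixes [x0], so the chain rule only involves differentials at [x0]. *)
Lemma is_diff_phi_word l :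
  is_diff x0 (phi_word_fun S w l) (fun v => v *m tangent_word l).
Proof.
elim: l => [|i l IHl] /=.
  by apply: is_diff_ext (is_diff_id x0) => // v; rewrite mulmx1.
have {}IHl : is_diff (phi_fun S w i x0) (phi_word_fun S w l)
    (fun v => v *m tangent_word l) by rewrite phi_fun_critical.
apply: is_diff_ext (is_diff_comp (is_diff_phi i) IHl) => // v /=.
by rewrite mulmxA.
Qed.

(** * Conjugation of the differentials to the reflections, and finiteness *)

Section Square_root.
Variable N : 'M[R]_d.
Hypothesis Nsqrt : is_sym_posdef_sqrt N (covariance S w x0).

Let scaling : 'M[R]_d := diag_mx (\row_i Num.sqrt (hessian i i)).

Lemma covarianceE i j : covariance S w x0 i j =
  hessian i j / (Num.sqrt (hessian i i) * Num.sqrt (hessian j j)).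
Proof.
rewrite [LHS]mxE -sqrtrM; last exact: ltW (hessian_diag_gt0 i).
by congr (_ / Num.sqrt (_ * _)); apply: partial2_inventory.
Qed.

Lemma hessian_covariance :
  hessian = scaling *m covariance S w x0 *m scaling.
Proof.
have sq0 k : Num.sqrt (hessian k k) != 0.
  by rewrite lt0r_neq0 ?sqrtr_gt0 ?hessian_diag_gt0.
have hE k : (\row_i Num.sqrt (hessian i i)) 0 k = Num.sqrt (hessian k k).
  by rewrite [LHS]mxE.
apply/matrixP => i j; rewrite mul_mx_diag mul_diag_mx [RHS]mxE [X in X * _]mxE.
by rewrite !hE covarianceE; field; rewrite !sq0.
Qed.

(** This squared norm is a diagonal entry of the covariance matrix, which has unit diagonal. *)
Lemma dotprod_sqrt_delta i :
  dotprod (N *m delta_mx i 0) (N *m delta_mx i 0) = 1.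
Proof.
have [[NT _] NN] := Nsqrt; have h0 := hessian_diag_gt0 i.
rewrite /dotprod trmx_mul NT mulmxA -[_ *m N *m N]mulmxA NN.
rewrite trmx_delta -rowE -colE 2!mxE covarianceE.
by rewrite -expr2 sqr_sqrtr ?ltW// divff// lt0r_neq0.
Qed.

(** Write D for [scaling] and e for the [i]-th unit vector. Both the column [hessian *m e] =
    sqrt(a_ii) D N (N e) and the row e^T D N = sqrt(a_ii) (N e)^T carry a factor sqrt(a_ii);
    together they cancel the denominator a_ii of [tangent i]. *)
Lemma tangent_reflection i :
  tangent i *m (scaling *m N) = scaling *m N *m reflection_r N i.
Proof.
have [[NT _] NN] := Nsqrt.
have h0 := hessian_diag_gt0 i.
pose e : 'cV[R]_d := delta_mx i 0.
have De : scaling *m e = Num.sqrt (hessian i i) *: e.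
  apply/matrixP => k l; rewrite mul_diag_mx !mxE.
  by case: eqP => [->|] //=; rewrite mulr0 mulr0.
have DT : scaling^T = scaling by rewrite tr_diag_mx.
have eT : e^T = delta_mx 0 i by rewrite trmx_delta.
have eD : e^T *m scaling = Num.sqrt (hessian i i) *: e^T.
  by rewrite -DT -trmx_mul De linearZ.
have Ne1 : dotprod (N *m e) (N *m e) = 1 := dotprod_sqrt_delta i.
rewrite /tangent /reflection_r /reflection -/e Ne1 divr1.
rewrite mulmxBl mulmxBr mul1mx mulmx1; congr (_ - _).
have -> : hessian *m e = Num.sqrt (hessian i i) *: (scaling *m N *m (N *m e)).
  by rewrite {1}hessian_covariance -mulmxA De -scalemxAr -NN !mulmxA.
rewrite -eT -!scalemxAl -!scalemxAr scalerA -[_ *m e^T *m _]mulmxA.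
rewrite [e^T *m _]mulmxA eD -scalemxAl -scalemxAr scalerA trmx_mul NT !mulmxA.
by rewrite -mulrA -expr2 sqr_sqrtr ?ltW// divfK ?lt0r_neq0.
Qed.

Lemma scaled_sqrt_unit : scaling *m N \in unitmx.
Proof.
rewrite unitmx_mul; apply/andP; split.
  rewrite unitmxE det_diag unitfE; apply/prodf_neq0 => i _.
  by rewrite mxE sqrtr_eq0 -ltNge hessian_diag_gt0.
have [[NT Npos] _] := Nsqrt.
rewrite unitmxE unitfE; apply/det0P => -[v v0 vN].
have := Npos v^T; rewrite trmx_eq0 => /(_ v0).
by rewrite -NT -trmx_mul vN trmx0 /dotprod mulmx0 mxE ltxx.
Qed.

Lemma tangent_word_reflection l : tangent_word l *m (scaling *m N) =
  scaling *m N *m foldr (fun i M => reflection_r N i *m M) 1%:M l.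
Proof.
elim: l => [|i l IHl] /=; first by rewrite mul1mx mulmx1.
by rewrite -mulmxA IHl mulmxA tangent_reflection mulmxA.
Qed.

(** [F] is quantified because [g] prescribes its values only on the orthant. No word is mentioned,
    so the matrix can be attached to the element of G itself. *)
Definition tangent_at (g : ratmap R d) (M : 'M[R]_d) : Prop :=
  exists F : 'rV[R]_d -> 'rV[R]_d,
    (forall j, represents (g j) (fun x => F x 0 j)) /\
    is_diff x0 F (fun v => v *m M).

(** Two functions representing [g] agree on the orthant, hence near [x0], and the rows of the
    matrices are their derivatives along the unit vectors. *)
Lemma tangent_at_inj g M M' : tangent_at g M -> tangent_at g M' -> M = M'.
Proof.
move=> [F [gF dF]] [G [gG dG]]; apply/row_matrixP => i.
rewrite !rowE -(is_diff_derive _ dF) -(is_diff_derive _ dG).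
apply: near_eq_derive; apply: filterS (near_orthant x0_gt0) => x xO.
by apply/rowP => j; apply: represents_inj (gF j) (gG j) xO.
Qed.

Lemma finite_groupH :
  finite_set (groupG S w) -> finite_set (groupH N).
Proof.
pose Q := scaling *m N.
(* The default 0 is taken only where no differential exists; every [phi_word S w l] has one, so the
   image of G under [f] contains all words in the reflections. *)
pose f g := invmx Q *m xget 0 [set M | tangent_at g M]%classic *m Q.
move=> /(finite_image f); apply: sub_finite_set => h.
have refl2 i : reflection_r N i *m reflection_r N i = 1%:M.
  by apply: reflectionK; rewrite dotprod_sqrt_delta oner_neq0.
move=> /(generated_involutions refl2)[l ->].
exists (phi_word S w l); first exact: phi_word_in_groupG.
have gl : tangent_at (phi_word S w l) (tangent_word l).
  exists (phi_word_fun S w l); split=> [j|]; last exact: is_diff_phi_word.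
  exact: (represents_phi_word wS steps).
rewrite /f; case: xgetP => [M _ /= gM|/(_ (tangent_word l))//].
rewrite (tangent_at_inj gM gl) -mulmxA tangent_word_reflection mulmxA.
by rewrite mulVmx ?mul1mx ?scaled_sqrt_unit.
Qed.
End Square_root.
End Tangent.

Theorem corollary7 (R : realType) (d : nat) (S : {fset 'rV[int]_d})
  (w : 'rV[int]_d -> R) (x0 : 'rV[R]_d) (sqrtDelta : 'M[R]_d) :
  (1 <= d)%N ->
  small_steps S ->
  weighting S w ->
  irreducible_in_orthant S w ->
  critical_point S w x0 ->
  is_sym_posdef_sqrt sqrtDelta (covariance S w x0) ->
  finite_set (groupG S w) ->
  finite_set (groupH sqrtDelta).
Proof.
move=> _ small wS irr crit Nsqrt; apply: (finite_groupH crit small wS _ Nsqrt).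
by move=> i a; apply: irreducible_step small irr.
Qed.
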